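(* Given a permutation $\delta$ of $[n]$, there exists a partial ascending permutation $\delta'\in\Delta$ such that the two lifted extended polymatroid inequalities defined by $\delta$ and by $\delta'$, namely $w\ge\sum_{i=1}^n\eta^{\delta}_{\delta_i}x_{\delta_i}$ and $w\ge\sum_{i=1}^n\eta^{\delta'}_{\delta'_i}x_{\delta'_i}$, are identical.
   Context: For a non-negative integer $m$, $[m]=\{1,\dots,m\}$ with $[0]=\varnothing$. Let $n,t$ be positive integers, $f:\mathbb{R}\to\mathbb{R}$ a concave function with $f(0)=0$, $a\in\mathbb{R}^n$ with non-negative entries, and $\{N_k\}_{k\in[t]}$ a partition of $[n]$ into consecutive blocks: with $i_0:=0$ and $i_k:=\sum_{j=1}^k|N_j|$, $N_k=\{i_{k-1}+1,\dots,i_k\}$. Within each block the entries of $a$ are ascending: $a_{i_{k-1}+1}\le\cdots\le a_{i_k}$ for all $k\in[t]$. For $S\subseteq[n]$, $a(S):=\sum_{i\in S}a_i$. For a permutation $\delta$ of $[n]$, let $\delta(j):=\{\delta_1,\dots,\delta_j\}$ and $\delta(0)=\varnothing$. The lifting coefficients are defined recursively for $j=1,\dots,n$ by $$\eta^{\delta}_{\delta_j}:=\min_{S}\Big\{ f(a(S))-\sum_{i\in S\setminus\{\delta_j\}}\eta^{\delta}_i \;:\; S\subseteq\delta(j),\ |S\cap N_k|\le 1\ \ \forall k\in[t],\ \delta_j\in S\Big\}.$$ A permutation $\delta$ of $[n]$ is called partial ascending if for all $i,j\in[n]$ and $k\in[t]$ with $i<j$ and $\delta_i,\delta_j\in N_k$,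 one has $\delta_i<\delta_j$. $\Delta$ denotes the set of all partial ascending permutations of $[n]$. *)

(* Defs.v *)
From mathcomp Require Import classical_sets reals interval_inference.
From mathcomp Require Import topology convex.
From mathcomp Require Import all_boot all_order all_fingroup all_algebra.

Set Implicit Arguments.
Unset Strict Implicit.
Unset Printing Implicit Defensive.
Import Order.TTheory GRing.Theory Num.Theory.
Local Open Scope ring_scope.

(* Positions, elements and blocks are numbered from 0, so the permutation
   delta = (delta_1, ..., delta_n) is d : 'S_n with delta_(j+1) = d j. *)

Definition concave (R : realType) (f : R -> R) : Prop :=
  convex_function (E := R^o) [set: R^o]%classic (fun x => - f x).

Lemma concaveP (R : realType) (f : R -> R) :
  concave f <->
  forall s x y : R, 0 <= s <= 1 ->
    s * f x + (1 - s) * f y <= f (s * x + (1 - s) * y).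
Proof.
split=> [cf s x y /andP[s0 s1]|cf s x y _ _].
  have := cf (Itv01 s0 s1) x y (mem_set I) (mem_set I).
  by rewrite -lerN2 opprK convN !opprK.
by rewrite -lerN2 opprK convN !opprK; apply: cf; rewrite ge0 le1.
Qed.

Section Blocks.
Variables (n t : nat) (N : 'I_t -> {set 'I_n}).

Definition block_bound (k : nat) : nat := (\sum_(j < t | j < k) #|N j|)%N.

Definition consecutive_partition : Prop :=
  partition [set N k | k : 'I_t] [set: 'I_n] /\
  forall k : 'I_t,
    N k = [set i : 'I_n | (block_bound k <= i < block_bound k.+1)%N].

Definition partial_ascending (d : 'S_n) : Prop :=
  forall (i j : 'I_n) (k : 'I_t),
    (i < j)%N -> d i \in N k -> d j \in N k -> (d i < d j)%N.

End Blocks.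

Section Lifting.
Variables (R : realType) (n t : nat) (f : R -> R) (a : 'rV[R]_n).
Variables (N : 'I_t -> {set 'I_n}) (d : 'S_n).

Definition prefix_set (j : nat) : {set 'I_n} := [set d i | i : 'I_n & (i < j)%N].

Definition feasible (j : 'I_n) (S : {set 'I_n}) : bool :=
  [&& S \subset prefix_set j.+1,
      [forall k, (#|S :&: N k| <= 1)%N] & d j \in S].

Definition lift_obj (h : 'I_n -> R) (j : 'I_n) (S : {set 'I_n}) : R :=
  f (\sum_(i in S) a 0 i) - \sum_(i in S :\ d j) h i.

(* The default value of the iterated minimum is the objective at [set d j],
   which is feasible, so this is the minimum over the feasible sets. *)
Definition lift_min (h : 'I_n -> R) (j : 'I_n) : R :=
  \big[Num.min/lift_obj h j [set d j]]_(S : {set 'I_n} | feasible j S)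
    lift_obj h j S.

(* After m steps, the coefficients of d 0, ..., d (m - 1) are set. *)
Fixpoint lift_upto (m : nat) : 'I_n -> R :=
  if m is m'.+1 then
    fun l => let j := (d^-1)%g l in
      if j == m' :> nat then lift_min (lift_upto m') j else lift_upto m' l
  else fun=> 0.

Definition lift_coef : 'I_n -> R := lift_upto n.

Definition lifted_ineq (x : 'rV[R]_n) (w : R) : bool :=
  w >= \sum_(i < n) lift_coef (d i) * x 0 (d i).

Lemma feasible1 (j : 'I_n) : feasible j [set d j].
Proof.
apply/and3P; split; last exact: set11.
  by rewrite sub1set; apply: imset_f; rewrite inE.
apply/forallP => k; apply: leq_trans (subset_leq_card (subsetIl _ _)) _.
by rewrite cards1.
Qed.

Lemma lift_upto_stable (m m' : nat) (i : 'I_n) :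
  (i < m)%N -> (m <= m')%N -> lift_upto m' (d i) = lift_upto m (d i).
Proof.
move=> im /subnKC <-; elim: (m' - m)%N => [|p IH]; first by rewrite addn0.
by rewrite addnS /= permK ltn_eqF // ltn_addr.
Qed.

Lemma eq_lift_obj (h h' : 'I_n -> R) (j : 'I_n) (S : {set 'I_n}) :
  (forall i : 'I_n, (i < j)%N -> h (d i) = h' (d i)) -> feasible j S ->
  lift_obj h j S = lift_obj h' j S.
Proof.
move=> hh' /and3P[/subsetP sS _ _]; congr (_ - _); apply: eq_bigr => i.
rewrite !inE => /andP[+ /sS/imsetP[l + il]]; rewrite il inE ltnS => ne lj.
apply: hh'; rewrite ltn_neqAle lj andbT.
by apply: contra ne => /eqP/val_inj ->.
Qed.

Lemma lift_coefE (j : 'I_n) : lift_coef (d j) = lift_min lift_coef j.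
Proof.
rewrite {1}/lift_coef (lift_upto_stable (leqnn j.+1)) //= permK eqxx.
have e (i : 'I_n) : (i < j)%N -> lift_upto j (d i) = lift_coef (d i).
  by move=> ij; rewrite /lift_coef (lift_upto_stable (leqnn i.+1) ij) (lift_upto_stable (leqnn i.+1)).
rewrite /lift_min (eq_lift_obj e (feasible1 j)).
by apply: eq_bigr => S; apply: eq_lift_obj.
Qed.

Lemma lift_coef_le (j : 'I_n) (S : {set 'I_n}) :
  feasible j S -> lift_coef (d j) <= lift_obj lift_coef j S.
Proof. by move=> jS; rewrite lift_coefE; apply: bigmin_le_cond. Qed.

Lemma lift_coef_attained (j : 'I_n) :
  exists2 S, feasible j S & lift_coef (d j) = lift_obj lift_coef j S.
Proof.
rewrite lift_coefE /lift_min; elim/big_ind: _ => [|u v [S Sf ->] [T Tf ->]|S Sf].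
- by exists [set d j] => //; apply: feasible1.
- by rewrite minEle; case: ifP => _; [exists S | exists T].
- by exists S.
Qed.

End Lifting.

(* Main.v *)
(* For a set P of elements already lifted, let M(P) collect the largest element
   of each block met by P.  Concavity of f gives, by induction along d, that the
   inequality is tight on M(P): the lifted coefficients of M(P) sum to
   f(a(M(P))).  For an element i, let j be the first element of its block with
   index at least i to appear in d, P what precedes j, and T the part of M(P)
   outside the block of i.  Then the coefficient of i is f(a_i + a(T)) minus the
   coefficients of T.  To see that no transversal S beats T, use concavity
   against the tight set T + j if a(S) >= a(T), and against M(P) otherwise.
   Hence only the time at which j appears matters, and sorting the elements i
   by that time, ties being broken by index, is partial ascending and changes no
   set T. *)

Require Import Defs.
From mathcomp Require Import all_boot all_order all_fingroup all_algebra.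
From mathcomp Require Import reals.
From mathcomp Require Import lra.
Set Implicit Arguments.
Unset Strict Implicit.
Unset Printing Implicit Defensive.
Import Order.TTheory GRing.Theory Num.Theory.
Local Open Scope ring_scope.

(** * An exchange inequality for concave functions, and sorting by a key *)

Lemma concave_submod (R : realType) (f : R -> R) (u v x y : R) :
  concave f -> u <= v -> x <= y -> f (v + y) + f (u + x) <= f (u + y) + f (v + x).
Proof.
move=> /concaveP cf uv xy.
have [e|ne] := eqVneq (v - u + (y - x)) 0.
  have -> : u = v by lra.
  have -> : x = y by lra.
  by [].
have gt0 : 0 < v - u + (y - x) by rewrite lt0r ne /=; lra.
(* Both [v + x] and [u + y] lie between [u + x] and [v + y]. They are its convex combinations with
   weights [s] and [1 - s] on [v + y], so adding the two concavity inequalities gives the claim. *)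
pose s := (v - u) / (v - u + (y - x)).
have s01 : 0 <= s <= 1.
  by rewrite /s divr_ge0 ?ler_pdivrMr ?mul1r //=; lra.
have s01' : 0 <= 1 - s <= 1 by move: s01 => /andP[? ?]; apply/andP; split; lra.
have es : s * (v - u + (y - x)) = v - u by rewrite /s divfK.
have := cf _ (v + y) (u + x) s01; have := cf _ (v + y) (u + x) s01'.
have -> : (1 - s) * (v + y) + (1 - (1 - s)) * (u + x) = u + y by lra.
have -> : s * (v + y) + (1 - s) * (u + x) = v + x by lra.
by lra.
Qed.

Lemma exists_perm_sorting n (key : 'I_n -> nat) : injective key ->
  exists s : 'S_n, forall i j, (s i < s j)%N = (key i < key j)%N.
Proof.
(* The rank of [i] is the number of elements with a smaller key. *)
move=> keyI; pose below i := [set j | (key j < key i)%N].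
have ltn_below i : (#|below i| < n)%N.
  have: (#|below i| < #|'I_n|)%N.
    by apply/proper_card/properP; split; [exact: subset_predT|exists i; rewrite ?inE ?ltnn].
  by rewrite card_ord.
have below_le i j : (key i <= key j)%N -> (#|below i| <= #|below j|)%N.
  move=> ij; apply/subset_leq_card/subsetP => l; rewrite !inE => li.
  exact: leq_trans li ij.
have below_lt i j : (#|below i| < #|below j|)%N = (key i < key j)%N.
  apply/idP/idP => [|ij]; first by rewrite ltnNge (ltnNge (key i)); apply: contra; apply: below_le.
  apply/proper_card/properP; split; last by exists i; rewrite !inE ?ltnn.
  by apply/subsetP => l; rewrite !inE => /ltn_trans; apply.
have rankI : injective (fun i => Ordinal (ltn_below i)).
  move=> i j [e]; apply: keyI; apply/eqP; rewrite eqn_leq.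
  by rewrite (leqNgt (key i)) (leqNgt (key j)) -!below_lt e ltnn.
by exists (perm rankI) => i j; rewrite !permE /= below_lt.
Qed.

(** * Records and block maxima along a permutation; [b] labels each element by its block *)

Section Records.
Variables (n : nat) (B : eqType) (b : 'I_n -> B) (d : 'S_n).

Definition pos (i : 'I_n) : nat := (d^-1)%g i.

(** The element [j] of the overview; [maxima p] is M(P) for P the first [p] elements of [d], and
    [other_maxima i] is T. *)
Definition record (i : 'I_n) : 'I_n :=
  [arg min_(j < i | (b j == b i) && (i <= j)%N) pos j]%N.

Definition maxima (p : nat) : {set 'I_n} :=
  [set m | (pos m < p)%N &
    [forall l, (b l == b m) && (pos l < p)%N ==> (l <= m)%N]].

Definition other_maxima (i : 'I_n) : {set 'I_n} :=
  [set m in maxima (pos (record i)) | b m != b i].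

Lemma pos_inj : injective pos.
Proof. by move=> i j /val_inj/perm_inj. Qed.

Lemma pos_perm (p : 'I_n) : pos (d p) = p.
Proof. by rewrite /pos permK. Qed.

Lemma recordP i : [/\ b (record i) = b i, (i <= record i)%N &
  forall j, b j = b i -> (i <= j)%N -> (pos (record i) <= pos j)%N].
Proof.
rewrite /record; case: arg_minnP => [|j /andP[/eqP bj ij] jmin].
  by rewrite eqxx leqnn.
by split=> // l bl il; apply: jmin; rewrite bl eqxx.
Qed.

Lemma pos_record_le i : (pos (record i) <= pos i)%N.
Proof. by have [_ _] := recordP i; apply. Qed.

Lemma pos_record_mono i j :
  b i = b j -> (i <= j)%N -> (pos (record i) <= pos (record j))%N.
Proof.
move=> bij ij; have [bj jr _] := recordP j; have [_ _] := recordP i.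
by apply; [rewrite bj|exact: leq_trans jr].
Qed.

Lemma maximaP p m : reflect ((pos m < p)%N /\
    forall l, b l = b m -> (pos l < p)%N -> (l <= m)%N) (m \in maxima p).
Proof.
rewrite inE; apply: (iffP andP) => -[mp mmax]; split=> //.
  move=> l bl lp; move/forallP: mmax => /(_ l); rewrite bl eqxx lp /=; apply.
by apply/forallP => l; apply/implyP => /andP[/eqP bl lp]; apply: mmax.
Qed.

Lemma maxima_inj p : {in maxima p &, injective b}.
Proof.
move=> i j /maximaP[ip imax] /maximaP[jp jmax] bij; apply/val_inj/eqP.
by rewrite eqn_leq jmax //= imax.
Qed.

Lemma exists_maximum p i :
  (pos i < p)%N -> exists2 m, m \in maxima p & b m = b i /\ (i <= m)%N.
Proof.
move=> ip; have: (b i == b i) && (pos i < p)%N by rewrite eqxx.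
case/(@arg_maxnP _ i (fun j => (b j == b i) && (pos j < p)%N) (@nat_of_ord n)).
move=> m /andP[/eqP bm mp] mmax; exists m.
  by apply/maximaP; split=> // l bl lp; apply: mmax; rewrite bl bm eqxx.
by split=> //; apply: mmax; rewrite eqxx.
Qed.

(** A new element that dominates its block so far replaces the maximum of that block, if any, and
    leaves the other blocks alone. *)
Lemma maxima_succ_record (j : 'I_n) :
  (forall l, b l = b j -> (pos l < pos j)%N -> (l <= j)%N) ->
  maxima (pos j).+1 = j |: [set m in maxima (pos j) | b m != b j].
Proof.
move=> jmax; apply/setP => m; rewrite in_setU1 in_set.
have [->|mj] /= := eqVneq m j.
  apply/maximaP; split=> // l bl; rewrite ltnS leq_eqVlt => /orP[/eqP/pos_inj->//|].
  exact: jmax.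
have pmj : (pos m < (pos j).+1)%N = (pos m < pos j)%N.
  by rewrite ltnS leq_eqVlt (inj_eq pos_inj) (negPf mj).
apply/maximaP/andP => -[].
  rewrite pmj => mp mmax; split.
    by apply/maximaP; split=> // l bl lp; apply: mmax => //; apply: leqW.
  apply: contra mj => /eqP bm; apply/eqP/val_inj/eqP.
  by rewrite eqn_leq jmax // mmax.
move=> /maximaP[mp mmax] bmj; rewrite pmj; split=> // l bl.
rewrite ltnS leq_eqVlt => /orP[/eqP/pos_inj lj|]; last exact: mmax.
by rewrite -bl lj eqxx in bmj.
Qed.

Lemma maxima_succ_nonrecord (j l : 'I_n) :
  b l = b j -> (pos l < pos j)%N -> (j < l)%N -> maxima (pos j).+1 = maxima (pos j).
Proof.
move=> bl lp jl; apply/setP => m.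
apply/maximaP/maximaP => -[mp mmax].
  have mj : m != j.
    by apply: contraTneq jl => mj; rewrite -leqNgt -mj mmax ?mj // leqW.
  split=> [|i bi ip]; last by rewrite mmax // leqW.
  by move: mp; rewrite ltnS leq_eqVlt (inj_eq pos_inj) (negPf mj).
split=> [|i bi]; first exact: leqW.
rewrite ltnS leq_eqVlt => /orP[/eqP/pos_inj ij|]; last exact: mmax.
by rewrite ij (leq_trans (ltnW jl)) // mmax // bl -ij.
Qed.

End Records.

(** * Validity, tightness and a closed form for the lifted coefficients *)

Section LiftedCoefficients.
Variables (R : realType) (n t : nat) (f : R -> R) (a : 'rV[R]_n).
Variables (N : 'I_t -> {set 'I_n}) (d : 'S_n) (B : eqType) (b : 'I_n -> B).
Hypotheses (f_concave : concave f) (f0 : f 0 = 0).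
Hypothesis a_ge0 : forall i, 0 <= a 0 i.
Hypothesis a_asc : forall i j, b i = b j -> (i <= j)%N -> a 0 i <= a 0 j.
Hypothesis transversalP : forall S : {set 'I_n},
  reflect {in S &, injective b} [forall k, (#|S :&: N k| <= 1)%N].

Local Notation h := (lift_coef f a N d).
Local Notation weight S := (\sum_(i in S) a 0 i).
Local Notation lifted S := (\sum_(i in S) h i).

Definition avoids (i : 'I_n) (S : {set 'I_n}) := forall l, l \in S -> b l != b i.

Lemma avoids_notin i (S : {set 'I_n}) : avoids i S -> i \notin S.
Proof. by move=> iS; apply/negP => /iS/eqP. Qed.

Lemma transversal_setU1 i (S : {set 'I_n}) :
  {in S &, injective b} -> avoids i S -> {in i |: S &, injective b}.
Proof.
move=> SI iS l m; rewrite !in_setU1.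
case/predU1P=> [->|lS]; case/predU1P=> [->|mS] // e; last exact: SI.
  by move: (iS m mS); rewrite e eqxx.
by move: (iS l lS); rewrite e eqxx.
Qed.

Lemma in_prefix_set i p : (i \in prefix_set d p) = (pos d i < p)%N.
Proof.
apply/imsetP/idP => [[l + ->]|ip]; first by rewrite inE pos_perm.
by exists ((d^-1)%g i); rewrite ?permKV // inE.
Qed.

Lemma feasibleP i (S : {set 'I_n}) : reflect
  [/\ {in S &, injective b}, i \in S & forall l, l \in S -> (pos d l <= pos d i)%N]
  (feasible N d ((d^-1)%g i) S).
Proof.
rewrite /feasible permKV; apply: (iffP and3P) => [[/subsetP Sp /transversalP SI iS]|].
  by split=> // l /Sp; rewrite in_prefix_set.
move=> [SI iS Sp]; split=> //; last exact/transversalP.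
by apply/subsetP => l /Sp; rewrite in_prefix_set.
Qed.

(** The element [j] of [S] lifted last makes [S] a feasible set in the minimum that defines
    [h j]. *)
Lemma lift_coef_valid (S : {set 'I_n}) :
  {in S &, injective b} -> lifted S <= f (weight S).
Proof.
move=> SI; have [->|[i iS]] := set_0Vmem S; first by rewrite !big_set0 f0.
case: (arg_maxnP (pos d) iS) => j jS jmax.
have /(lift_coef_le f a) : feasible N d ((d^-1)%g j) S by apply/feasibleP; split.
by rewrite /lift_obj permKV [lifted S](big_setD1 j) //=; lra.
Qed.

Lemma lift_coef_setU1_valid i (S : {set 'I_n}) :
  {in S &, injective b} -> avoids i S -> h i + lifted S <= f (a 0 i + weight S).
Proof.
move=> SI iS; have := lift_coef_valid (transversal_setU1 SI iS).
by rewrite !big_setU1 ?avoids_notin.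
Qed.

Lemma lift_coef_minimizer i : exists S : {set 'I_n},
  [/\ {in S &, injective b}, avoids i S,
      forall l, l \in S -> (pos d l < pos d i)%N
    & h i = f (a 0 i + weight S) - lifted S].
Proof.
have [S /feasibleP[SI iS Sp]] := lift_coef_attained f a N d ((d^-1)%g i).
rewrite /lift_obj permKV [weight S](big_setD1 i) //= => hi.
exists (S :\ i); split=> // [l m /setD1P[_ lS] /setD1P[_ mS]|l|l].
- exact: SI.
- by case/setD1P => li lS; apply: contra li => /eqP/SI->.
- case/setD1P => li lS; rewrite ltn_neqAle Sp // andbT.
  by apply: contra li => /eqP/pos_inj->.
Qed.

(** Choosing a dominating element of [T] for each element of [S] is injective, as it preserves
    blocks. Weights increase along this map, and the rest of [T] has non-negative weight. *)
Lemma weight_le_dominated (S T : {set 'I_n}) : {in S &, injective b} ->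
  (forall s, s \in S -> exists2 m, m \in T & b m = b s /\ (s <= m)%N) ->
  weight S <= weight T.
Proof.
move=> SI dom.
pose g s := odflt s [pick m in T | (b m == b s) && (s <= m)%N].
have gP s : s \in S -> [/\ g s \in T, b (g s) = b s & (s <= g s)%N].
  move=> /dom[m mT [bm sm]]; rewrite /g; case: pickP => [l /and3P[? /eqP ? ?] //|].
  by move/(_ m); rewrite /= mT bm eqxx sm.
have gI : {in S &, injective g}.
  move=> x y xS yS gxy; apply: SI => //.
  by have [_ <- _] := gP x xS; have [_ <- _] := gP y yS; rewrite gxy.
have gT : g @: S \subset T by apply/subsetP => _ /imsetP[s /gP[? _ _] ->].
apply: (@le_trans _ _ (weight (g @: S))).
  rewrite big_imset //=; apply: ler_sum => s /gP[_ bg sg].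
  by apply: a_asc; rewrite ?bg.
rewrite [leRHS](big_setID (g @: S)) /= (setIidPr gT) lerDl.
by apply: sumr_ge0.
Qed.

(* The element of block [b i] in [maxima p] provides [u] and [c]; when the
   block is not represented there, [u = c = 0]. *)
Lemma maxima_swap i p (T := [set m in maxima b d p | b m != b i]) :
  (forall l, b l = b i -> (pos d l < p)%N -> (l <= i)%N) ->
  lifted (maxima b d p) = f (weight (maxima b d p)) ->
  exists u c, [/\ u <= a 0 i, f (u + weight T) = c + lifted T &
    forall S : {set 'I_n}, {in S &, injective b} -> avoids i S ->
      c + lifted S <= f (u + weight S)].
Proof.
move=> imax tight.
have [m /andP[mE /eqP bm]|none] := pickP [pred m in maxima b d p | b m == b i].
  have ET : maxima b d p = m |: T.
    apply/setP => l; rewrite in_setU1 [l \in T]in_set; have [->|lm] //= := eqVneq l m.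
    apply/idP/andP => [lE|[]//]; split=> //; apply: contra lm => /eqP bl.
    by apply/eqP/(maxima_inj lE mE); rewrite bl bm.
  have mT : m \notin T by rewrite in_set bm eqxx andbF.
  exists (a 0 m), (h m); split.
  - by case/maximaP: mE => mp _; apply: a_asc => //; apply: imax.
  - by move: tight; rewrite ET !big_setU1.
  - move=> S SI iS; apply: lift_coef_setU1_valid => // l /iS; by rewrite bm.
have -> : T = maxima b d p.
  by apply/setP => l; rewrite in_set; have /= := none l; case: (l \in _) => //= ->.
exists 0, 0; split=> // [|S SI _]; first by rewrite !add0r.
by rewrite !add0r; apply: lift_coef_valid.
Qed.

Lemma lift_coef_record j (T := [set m in maxima b d (pos d j) | b m != b j]) :
  (forall l, b l = b j -> (pos d l < pos d j)%N -> (l <= j)%N) ->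
  lifted (maxima b d (pos d j)) = f (weight (maxima b d (pos d j))) ->
  h j + lifted T = f (a 0 j + weight T).
Proof.
move=> jmax tight.
have TI : {in T &, injective b}.
  by move=> x y /setIdP[xE _] /setIdP[yE _]; apply: maxima_inj xE yE.
have jT : avoids j T by move=> l /setIdP[].
apply/le_anti/andP; split; first exact: lift_coef_setU1_valid.
have [u [c [uj fu cS]]] := maxima_swap jmax tight.
have [S [SI jS Sp ->]] := lift_coef_minimizer j.
(* The minimizer uses only elements lifted before [j], each dominated by the maximum of its
   block. *)
have ST : weight S <= weight T.
  apply: weight_le_dominated => // s sS.
  have [m mE [bm sm]] := exists_maximum b (Sp s sS).
  by exists m => //; apply/setIdP; rewrite mE bm jS.
have := concave_submod f_concave uj ST; have := cS S SI jS; rewrite -/T in fu *.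
by lra.
Qed.

(** Induction along [d]: the next element either leaves the maxima unchanged, or is a new block
    maximum, and then [lift_coef_record] applies. *)
Lemma maxima_tight p :
  (p <= n)%N -> lifted (maxima b d p) = f (weight (maxima b d p)).
Proof.
elim: p => [_|p IH pn].
  have -> : maxima b d 0 = set0 by apply/setP => m; rewrite !inE.
  by rewrite !big_set0 f0.
pose j := d (Ordinal pn); have pj : pos d j = p by rewrite pos_perm.
rewrite -pj in IH *.
have [l /and3P[/eqP bl lp jl]|none] :=
    pickP [pred l | [&& b l == b j, pos d l < pos d j & j < l]%N].
  by rewrite (maxima_succ_nonrecord bl lp jl) IH // pj ltnW.
have jmax l : b l = b j -> (pos d l < pos d j)%N -> (l <= j)%N.
  by move=> bl lp; have := none l; rewrite /= bl eqxx lp /= ltnNge => /negbFE.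
have jT : j \notin [set m in maxima b d (pos d j) | b m != b j].
  by rewrite inE eqxx andbF.
rewrite maxima_succ_record // !big_setU1 //.
by apply: lift_coef_record => //; apply: IH; rewrite pj ltnW.
Qed.

(** Unlike in [lift_coef_record], the minimizer [S] may contain elements lifted between [j] and [i],
    so its weight may exceed that of [T]; hence the two cases at the end. *)
Lemma lift_coef_other_maxima i :
  h i = f (a 0 i + weight (other_maxima b d i)) - lifted (other_maxima b d i).
Proof.
have [bj ij jmin] := recordP b d i; set j := record b d i in bj ij jmin.
(* Until [j] appears, its block shows only indices at most [i], so the swap can be made with [i] at
   the time of [j]. *)
have before l : b l = b i -> (pos d l < pos d j)%N -> (l <= i)%N.
  move=> bl lp; rewrite leqNgt; apply: contraTN lp => il.
  by rewrite -leqNgt jmin // ltnW.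
have jn : (pos d j < n)%N by apply: ltn_ord.
have [u [c [ui fu cS]]] := maxima_swap before (maxima_tight (ltnW jn)).
rewrite -/(other_maxima b d i) in fu; set T := other_maxima b d i in fu *.
have fj : h j + lifted T = f (a 0 j + weight T).
  have -> : T = [set m in maxima b d (pos d j) | b m != b j].
    by apply/setP => m; rewrite !in_set bj.
  apply: lift_coef_record; last exact: maxima_tight (ltnW jn).
  by move=> l; rewrite bj => bl lp; apply: leq_trans ij; apply: before.
have TI : {in T &, injective b}.
  by move=> x y /setIdP[xE _] /setIdP[yE _]; apply: maxima_inj xE yE.
have iT : avoids i T by move=> l /setIdP[].
have hT := lift_coef_setU1_valid TI iT.
apply/le_anti/andP; split; first by lra.
have [S [SI iS _ ->]] := lift_coef_minimizer i.
have aij : a 0 i <= a 0 j by apply: a_asc.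
case/orP: (le_total (weight S) (weight T)) => ST.
  by have := concave_submod f_concave ui ST; have := cS S SI iS; lra.
have jS : avoids j S by move=> l /iS; rewrite bj.
(* Here [T] is the lighter set: exchange [a 0 i] with [a 0 j], using that [j |: T] is tight and
   [j |: S] valid. *)
have := concave_submod f_concave aij ST; have := lift_coef_setU1_valid SI jS; lra.
Qed.

End LiftedCoefficients.

(** * Sorting by record time preserves the sets T *)

Section AscendingRearrangement.
Variables (n : nat) (B : eqType) (b : 'I_n -> B) (d d' : 'S_n).

(* Encodes the lexicographic order on pairs (position of the record of [i], [i]). *)
Definition record_key (i : 'I_n) : nat := (pos d (record b d i) * n + i)%N.

Hypothesis d'_sorted :
  forall i j, (pos d' i < pos d' j)%N = (record_key i < record_key j)%N.

Lemma record_key_lt i j : (record_key i < record_key j)%N =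
  (pos d (record b d i) < pos d (record b d j))%N ||
  ((pos d (record b d i) == pos d (record b d j)) && (i < j)%N).
Proof.
rewrite /record_key; have := ltn_ord i; have := ltn_ord j.
set p := pos d _; set q := pos d _ => jn im.
have [pq|qp|->] := ltngtP p q; rewrite ?ltn_add2l //=.
  apply: (@leq_trans (p.+1 * n)); first by rewrite mulSn addnC ltn_add2r.
  by apply: leq_trans (leq_addr _ _); rewrite leq_mul2r pq orbT.
apply/negbTE; rewrite -leqNgt; apply: (@leq_trans (q.+1 * n)).
  by rewrite mulSn addnC leq_add2r ltnW.
by apply: leq_trans (leq_addr _ _); rewrite leq_mul2r qp orbT.
Qed.

Lemma record_key_mono i j :
  b i = b j -> (i < j)%N -> (record_key i < record_key j)%N.
Proof.
move=> bij ij; rewrite record_key_lt ij andbT orbC -leq_eqVlt.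
exact: pos_record_mono (ltnW ij).
Qed.

Lemma record_sorted i : record b d' i = i.
Proof.
have [bj ij jmin] := recordP b d' i; apply/val_inj/eqP; rewrite /= eqn_leq ij andbT.
rewrite leqNgt; apply/negP => /(record_key_mono (esym bj)).
by rewrite -d'_sorted ltnNge jmin.
Qed.

(** A record stays in its block, so ties in record time, which the index breaks, occur only within a
    block. *)
Lemma sorted_lt_other_block i j : b i != b j ->
  (pos d' i < pos d' j)%N = (pos d (record b d i) < pos d (record b d j))%N.
Proof.
move=> bij; rewrite d'_sorted record_key_lt.
case: eqP => [/pos_inj e|_]; last by rewrite orbF.
have [bi _ _] := recordP b d i; have [bj _ _] := recordP b d j.
by move: bij; rewrite -bi -bj e eqxx.
Qed.

(** In another block, the elements preceding [i] in [d'] are those whose record appears in [d]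
    before the record of [i]. They form the downward closure, within the block, of what [d] shows by
    then, so the maximum is the same. *)
Lemma other_maxima_sorted i : other_maxima b d' i = other_maxima b d i.
Proof.
rewrite /other_maxima record_sorted; apply/setP => m.
rewrite 2!in_set; have [|bmi] := boolP (b m != b i); rewrite ?andbF ?andbT // => bmi.
set p := pos d (record b d i).
have lt l : b l = b m -> (pos d' l < pos d' i)%N = (pos d (record b d l) < p)%N.
  by move=> bl; apply: sorted_lt_other_block; rewrite bl.
have [brm mr rmin] := recordP b d m.
apply/maximaP/maximaP => -[mp mmax].
  rewrite lt // in mp.
  (* The record of [m] also precedes [i] in [d'], so maximality of [m] bounds it. *)
  have rm : record b d m = m.
    apply/val_inj/eqP; rewrite eqn_leq mr andbT mmax // lt //.
    exact: leq_ltn_trans (pos_record_le _ _ _) mp.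
  split=> [|l bl lp]; first by rewrite -rm.
  by apply: mmax => //; rewrite lt //; apply: leq_ltn_trans (pos_record_le _ _ _) lp.
split=> [|l bl]; first by rewrite lt //; apply: leq_ltn_trans (pos_record_le _ _ _) mp.
rewrite lt // => lp; have [brl lr _] := recordP b d l.
by apply: leq_trans lr (mmax _ _ lp); rewrite brl.
Qed.

End AscendingRearrangement.

Lemma sorted_by_record_key n (B : eqType) (b : 'I_n -> B) (d : 'S_n) :
  exists d' : 'S_n, forall i j,
    (pos d' i < pos d' j)%N = (record_key b d i < record_key b d j)%N.
Proof.
have keyI : injective (record_key b d).
  move=> i j /(congr1 (modn^~ n)); rewrite /= !modnMDl !modn_small //.
  exact: val_inj.
have [s sP] := exists_perm_sorting keyI.
(* [s] maps elements to positions, whereas a lifting order maps positions to elements. *)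
by exists s^-1%g => i j; rewrite /pos invgK sP.
Qed.

(** With the block [pblock P i] as the label of [i], the constraint of one element per block becomes
    injectivity of the labelling on [S]. *)
Lemma trivIset_transversalP (n t : nat) (N : 'I_t -> {set 'I_n})
    (P := [set N k | k : 'I_t]) :
  partition P [set: 'I_n] -> forall S : {set 'I_n},
  reflect {in S &, injective (pblock P)} [forall k, (#|S :&: N k| <= 1)%N].
Proof.
case/and3P=> /eqP Pcover Ptriv _ S.
have blockE k i : i \in N k -> pblock P i = N k.
  by apply: def_pblock Ptriv _; apply: imset_f.
apply: (iffP forallP) => [SN i j iS jS e|SI k]; last first.
  apply/card_le1_eqP => i j /setIP[iS /blockE iN] /setIP[jS /blockE jN].
  by apply: SI; rewrite // iN jN.
have : i \in cover P by rewrite Pcover inE.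
rewrite -mem_pblock => iP.
have /imsetP[k _ Nk] : pblock P i \in P by rewrite pblock_mem // Pcover inE.
have /card_le1_eqP := SN k; apply; rewrite inE ?iS ?jS -Nk //=.
by rewrite e mem_pblock Pcover inE.
Qed.

(** * Equality of the two lifted inequalities *)

Theorem corollary4p8 (R : realType) (n t : nat) (n_gt0 : (0 < n)%N)
    (t_gt0 : (0 < t)%N) (f : R -> R) (f_concave : concave f) (f0 : f 0 = 0)
    (a : 'rV[R]_n) (a_ge0 : forall i, 0 <= a 0 i)
    (N : 'I_t -> {set 'I_n}) (N_part : consecutive_partition N)
    (a_asc : forall (k : 'I_t) (i j : 'I_n),
      i \in N k -> j \in N k -> (i <= j)%N -> a 0 i <= a 0 j)
    (d : 'S_n) :
  exists d' : 'S_n,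
    [/\ partial_ascending N d',
        forall i : 'I_n, lift_coef f a N d i = lift_coef f a N d' i
      & forall (x : 'rV[R]_n) (w : R),
          lifted_ineq f a N d x w = lifted_ineq f a N d' x w].
Proof.
have [part _] := N_part; set P := [set N k | k : 'I_t] in part.
have [/eqP Pcover Ptriv _] := and3P part.
pose b := pblock P.
have transversalP := trivIset_transversalP part.
have blockE k i : i \in N k -> b i = N k.
  by apply: def_pblock Ptriv _; apply: imset_f.
have b_asc i j : b i = b j -> (i <= j)%N -> a 0 i <= a 0 j.
  move=> bij; have in_b l : l \in b l by rewrite mem_pblock Pcover inE.
  have /imsetP[k _ Nk] : b i \in P by rewrite pblock_mem // Pcover inE.
  by apply: (a_asc k); rewrite -Nk // bij.
have [d' sorted] := sorted_by_record_key b d; exists d'.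
have coefE i : lift_coef f a N d i = lift_coef f a N d' i.
  (* Strong induction on record time: the members of T appear in [d] before the record of [i], hence
     so do their records. *)
  have [m] := ubnP (pos d (record b d i)); elim: m i => // m IH i im.
  rewrite !(lift_coef_other_maxima _ f_concave f0 a_ge0 b_asc transversalP).
  rewrite (other_maxima_sorted sorted); congr (_ - _); apply: eq_bigr => l.
  case/setIdP=> /maximaP[lp _] _; apply: IH.
  by apply: leq_ltn_trans (pos_record_le _ _ _) (leq_trans lp _).
split=> // [i j k ij iN jN|x w].
  rewrite ltnNge leq_eqVlt negb_or; apply/andP; split.
    by apply: contraTneq ij => /val_inj/perm_inj->; rewrite ltnn.
  apply: contraTN ij => ji; rewrite -leqNgt -(pos_perm d' i) -(pos_perm d' j) ltnW //.
  by rewrite sorted record_key_mono // !(blockE k).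
have sumE e : \sum_(i < n) lift_coef f a N e (e i) * x 0 (e i) =
    \sum_i lift_coef f a N e i * x 0 i.
  by rewrite [RHS](reindex_inj (@perm_inj _ e)).
rewrite /lifted_ineq !sumE; congr (_ <= _); apply: eq_bigr => i _.
by rewrite coefE.
Qed.
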